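(* Let $G$ be a graph on the vertex set $\{1,\dots,n\}$ with adjacency matrix $\Gamma$ over $\mathbb{F}_2$, and let $q(G,x)=\sum_{i=0}^n a_i x^i$ be its interlace polynomial. Then $|\Sigma_e(G)|$ divides every coefficient $a_i$. In particular, if $\Sigma_e(G)\neq\{0\}$, then all coefficients $a_i$ are even.
   Context: Graphs are finite, undirected and simple; the adjacency matrix $\Gamma$ is regarded as a matrix over $\mathbb{F}_2$ (symmetric, zero diagonal). For $\omega\subseteq\{1,\dots,n\}$, $\Gamma[\omega]=(\Gamma_{ij})_{i,j\in\omega}$, and $s(X)$ denotes the corank (dimension of the kernel) over $\mathbb{F}_2$ of a square matrix $X$, with $s(\Gamma[\emptyset])=0$. The interlace polynomial of $G$ is the integer polynomial $q(G,x)=\sum_{\omega\subseteq\{1,\dots,n\}}(x-1)^{s(\Gamma[\omega])}$. For $x\in\mathbb{F}_2^n$, $\hat{x}$ is the diagonal matrix with the entries of $x$ on its diagonal. For a diagonal $n\times n$ matrix $A$ over $\mathbb{F}_2$, $H^A(\Gamma)=((A+I)\Gamma+A)(A\Gamma+A+I)^{-1}$, defined when $A\Gamma+A+I$ is nonsingular. $\Sigma_e(G)$ is the set of all $x\in\mathbb{F}_2^n$ for which $H^{\hat{x}}(\Gamma)$ is defined and equals $\Gamma$; equivalently, the linear space $\Sigma_e(G)=\{x\in\mathbb{F}_2^n\mid(\Gamma+I)\hat{x}(\Gamma+I)=0\}$ (over $\mathbb{F}_2$). *)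

(* Defs.v *)
From mathcomp Require Import all_boot all_order all_algebra.
Set Implicit Arguments.
Unset Strict Implicit.
Unset Printing Implicit Defensive.
Import GRing.Theory.
Local Open Scope ring_scope.

(* A simple graph on n vertices is a symmetric irreflexive relation on 'I_n;
   the definitions take an arbitrary relation and the two properties are left
   to the hypotheses of theorems. *)

Definition adjacency (n : nat) (e : rel 'I_n) : 'M['F_2]_n :=
  \matrix_(i, j) (e i j)%:R.

Definition princ_submx (n : nat) (M : 'M['F_2]_n) (w : {set 'I_n}) :
    'M['F_2]_#|w| :=
  mxsub (@enum_val _ (mem w)) (@enum_val _ (mem w)) M.

(* [kermx] spans the kernel acting on row vectors; for a square matrix the
   row and column kernels have the same dimension. *)
Definition corank (m : nat) (X : 'M['F_2]_m) : nat := \rank (kermx X).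

Definition interlace_poly (n : nat) (e : rel 'I_n) : {poly int} :=
  \sum_(w : {set 'I_n}) ('X - 1) ^+ corank (princ_submx (adjacency e) w).

Definition Hdenom (n : nat) (A M : 'M['F_2]_n) : 'M['F_2]_n :=
  A *m M + A + 1%:M.

(* Only meaningful when [Hdenom A M] is invertible, since [invmx] is total. *)
Definition H_op (n : nat) (A M : 'M['F_2]_n) : 'M['F_2]_n :=
  ((A + 1%:M) *m M + A) *m invmx (Hdenom A M).

Definition Sigma_e (n : nat) (e : rel 'I_n) : {set 'rV['F_2]_n} :=
  [set x | (Hdenom (diag_mx x) (adjacency e) \in unitmx)
           && (H_op (diag_mx x) (adjacency e) == adjacency e)].

(* Main.v *)
Require Import Defs.
From mathcomp Require Import all_boot all_order all_algebra all_fingroup cyclic.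
Set Implicit Arguments.
Unset Strict Implicit.
Unset Printing Implicit Defensive.
Import GRing.Theory.
Local Open Scope ring_scope.

(** Put [K = Gamma + I] and write [D x] for the diagonal matrix of [x]; subsets
    are identified with their indicator vectors. The principal submatrix
    [Gamma[w]] has the same corank as the [n x n] matrix [D w * K + I], and [x]
    lies in [Sigma_e] iff [K * D x * K = 0]. For such [x],
    [D (w + x) * K + I = (D w * K + I) * (D x * K + I)] and the last factor is
    an involution, so [w] and [w + x] contribute the same term to the interlace
    polynomial: its terms are constant on the cosets of the group [Sigma_e]. *)

(** As [E *m E^T] is the identity, [E^T *m E] is a projector. In the splitting given by it and its
    complement [C], the matrix on the right is block triangular with diagonal blocks [E *m A *m E^T]
    and an identity, which adds nothing to the kernel. *)
Lemma corank_compression (F : fieldType) (m n : nat) (E : 'M[F]_(m, n))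
    (A : 'M[F]_n) :
  E *m E^T = 1%:M ->
  \rank (kermx (E *m A *m E^T)) =
  \rank (kermx (E^T *m E *m A + (1%:M - E^T *m E))).
Proof.
move=> EEt; set C := 1%:M - E^T *m E; set M := _ + C.
have EC : E *m C = 0 by rewrite mulmxBr mulmx1 mulmxA EEt mul1mx subrr.
have CE : C *m E^T = 0 by rewrite mulmxBl mul1mx -mulmxA EEt mulmx1 subrr.
have CC : C *m C = C by rewrite {1}/C mulmxBl mul1mx -mulmxA EC mulmx0 subr0.
have ME : M *m E^T = E^T *m (E *m A *m E^T).
  by rewrite mulmxDl CE addr0 !mulmxA.
have MC : M *m C = E^T *m (E *m A *m C) + C by rewrite mulmxDl CC !mulmxA.
have CM : C *m M = C by rewrite mulmxDr CC !mulmxA CE !mul0mx add0r.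
have EM : E *m M = E *m A by rewrite mulmxDr EC addr0 !mulmxA EEt mul1mx.
apply/eqP; rewrite eqn_leq; apply/andP; split.
(* A kernel vector [u] of the small matrix lifts to [u *m E], corrected in the range of [C] to
   cancel the off-diagonal block; [E^T] undoes the lift. *)
- set K := kermx _; pose L := K *m (E - E *m A *m C).
  have LE : L *m E^T = K.
    by rewrite -mulmxA mulmxBl EEt -(mulmxA (E *m A)) CE mulmx0 subr0 mulmx1.
  rewrite -{1}LE (leq_trans (mxrankM_maxl _ _)) //.
  apply: mxrankS; apply/sub_kermxP.
  rewrite -mulmxA mulmxBl EM -(mulmxA (E *m A)) CM.
  rewrite -{1}[E *m A]mulmx1 -mulmxBr subKr.
  by rewrite (mulmxA (E *m A)) mulmxA mulmx_ker mul0mx.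
- set K := kermx M; have KM : K *m M = 0 by rewrite mulmx_ker.
  (* The [C]-part of a kernel vector is determined by its image under [E^T], so that [E^T] is
     injective on the kernel. *)
  have KC : K *m C = - (K *m E^T *m (E *m A *m C)).
    by apply/eqP; rewrite -addr_eq0 addrC -mulmxA -mulmxDr -MC mulmxA KM mul0mx.
  have KE : K *m E^T *m (E - E *m A *m C) = K.
    by rewrite mulmxBr -KC -mulmxA -mulmxDr addrC subrK mulmx1.
  rewrite -{1}KE (leq_trans (mxrankM_maxl _ _)) //.
  by apply: mxrankS; apply/sub_kermxP; rewrite -mulmxA -ME mulmxA KM mul0mx.
Qed.

Lemma addmx_F2 (m n : nat) (A : 'M['F_2]_(m, n)) : A + A = 0.
Proof.
apply/matrixP=> i j; rewrite !mxE.
exact: (addrr_pchar2 (pchar_Fp (isT : prime 2))).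
Qed.

Lemma oppmx_F2 (m n : nat) (A : 'M['F_2]_(m, n)) : - A = A.
Proof. by apply/eqP; rewrite eq_sym -addr_eq0 addmx_F2. Qed.

Definition indicator_row (n : nat) (w : {set 'I_n}) : 'rV['F_2]_n :=
  \row_i (i \in w)%:R.

Definition row_support (n : nat) (x : 'rV['F_2]_n) : {set 'I_n} :=
  [set i | x 0 i != 0].

Lemma row_supportK (n : nat) : cancel (@row_support n) (@indicator_row n).
Proof.
move=> x; apply/rowP=> i; rewrite !mxE inE.
by case: (x 0 i) => -[|[|//]] lt_i; apply: val_inj.
Qed.

Lemma indicator_rowK (n : nat) : cancel (@indicator_row n) (@row_support n).
Proof. by move=> w; apply/setP=> i; rewrite inE mxE; case: (i \in w). Qed.

Lemma corank_princ_submx (n : nat) (M : 'M['F_2]_n) (w : {set 'I_n}) :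
  corank (princ_submx M w) = corank (Hdenom (diag_mx (indicator_row w)) M).
Proof.
pose f : 'I_#|w| -> 'I_n := @enum_val _ (mem w).
(* [E] selects the coordinates in [w], hence [E^T *m E] is the diagonal matrix of [w]. *)
pose E : 'M['F_2]_(#|w|, n) := rowsub f 1%:M.
have EM (p : nat) (A : 'M_(n, p)) : E *m A = rowsub f A.
  by rewrite mul_rowsub_mx mul1mx.
have ME (p : nat) (A : 'M_(p, n)) : A *m E^T = colsub f A.
  by apply: trmx_inj; rewrite trmx_mul trmxK EM trmx_mxsub.
have EEt : E *m E^T = 1%:M.
  rewrite ME; apply/matrixP=> i j; rewrite !mxE.
  by rewrite (inj_eq enum_val_inj).
have EtE : E^T *m E = diag_mx (indicator_row w).
  apply/matrixP=> i j; rewrite !mxE.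
  under eq_bigr => k _ do rewrite !mxE -natrM mulnb.
  have [iw|iNw] := boolP (i \in w).
    rewrite (bigD1 (enum_rank_in iw i)) //= /f enum_rankK_in // eqxx /=.
    rewrite big1 ?addr0 // => k /negP nk; case: eqP => // ek.
    by case: nk; apply/eqP; apply: enum_val_inj; rewrite enum_rankK_in.
  rewrite mul0rn big1 // => k _; case: eqP => // ek.
  by move: iNw; rewrite -ek /f enum_valP.
have -> : princ_submx M w = E *m M *m E^T.
  by rewrite ME EM; apply/matrixP=> i j; rewrite !mxE.
rewrite /corank corank_compression // EtE /Hdenom oppmx_F2.
by rewrite -addrA [1%:M + _]addrC.
Qed.

Lemma HdenomE (n : nat) (A M : 'M['F_2]_n) :
  Hdenom A M = A *m (M + 1%:M) + 1%:M.
Proof. by rewrite mulmxDr mulmx1. Qed.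

Lemma Hdenom_involutive (n : nat) (A M : 'M['F_2]_n) :
  (M + 1%:M) *m A *m (M + 1%:M) = 0 -> Hdenom A M *m Hdenom A M = 1%:M.
Proof.
move=> KAK; rewrite HdenomE mulmxDr mulmxDl mulmx1 mul1mx -!mulmxA.
by rewrite (mulmxA _ A) KAK mulmx0 add0r addrA addmx_F2 add0r.
Qed.

(** With [K = M + 1%:M], the product has the single extra term [A *m K *m B *m K], which contains
    [K *m B *m K]; so [A] may be arbitrary. *)
Lemma Hdenom_add (n : nat) (A B M : 'M['F_2]_n) :
  (M + 1%:M) *m B *m (M + 1%:M) = 0 ->
  Hdenom (A + B) M = Hdenom A M *m Hdenom B M.
Proof.
move=> KBK; rewrite !HdenomE mulmxDr mulmx1 !mulmxDl mul1mx -!mulmxA.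
by rewrite (mulmxA _ B) KBK mulmx0 add0r addrCA addrA.
Qed.

(** The numerator of [H_op A M] differs from [M *m Hdenom A M] by exactly the matrix required to
    vanish. Conversely, that vanishing makes the denominator an involution, hence invertible. *)
Lemma H_op_fixedP (n : nat) (A M : 'M['F_2]_n) :
  reflect ((M + 1%:M) *m A *m (M + 1%:M) = 0)
          ((Hdenom A M \in unitmx) && (H_op A M == M)).
Proof.
have numE : (A + 1%:M) *m M + A =
            M *m Hdenom A M + (M + 1%:M) *m A *m (M + 1%:M).
  rewrite HdenomE -mulmxA mulmxDr mulmx1 [in RHS]mulmxDl mul1mx.
  rewrite addrAC addrA addmx_F2 add0r mulmxDl mul1mx mulmxDr mulmx1.
  by rewrite addrAC.
apply: (iffP andP) => [[uD /eqP HM]|KAK].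
  move: (congr1 (mulmx^~ (Hdenom A M)) HM); rewrite mulmxKV // numE => KAK.
  by apply: (addrI (M *m Hdenom A M)); rewrite KAK addr0.
have [uD _] := mulmx1_unit (Hdenom_involutive KAK).
by rewrite uD /H_op numE KAK addr0 mulmxK.
Qed.

Lemma Sigma_eP (n : nat) (e : rel 'I_n) (x : 'rV['F_2]_n) :
  reflect ((adjacency e + 1%:M) *m diag_mx x *m (adjacency e + 1%:M) = 0)
          (x \in Sigma_e e).
Proof. by rewrite inE; apply: H_op_fixedP. Qed.

Lemma Sigma_e_group_set (n : nat) (e : rel 'I_n) : group_set (Sigma_e e).
Proof.
apply/group_setP; split=> [|x y /Sigma_eP Kx /Sigma_eP Ky]; apply/Sigma_eP.
  by rewrite (raddf0 (@diag_mx _ n)) mulmx0 mul0mx.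
rewrite -[(x * y)%g]/(x + y) (raddfD (@diag_mx _ n)).
by rewrite [X in X *m _]mulmxDr mulmxDl Kx Ky addr0.
Qed.

Lemma corank_mulmxU (m : nat) (A U : 'M['F_2]_m) :
  U \in unitmx -> corank (A *m U) = corank A.
Proof.
by move=> uU; rewrite /corank !mxrank_ker mxrankMfree ?row_free_unit.
Qed.

Lemma corank_Hdenom_Sigma_e (n : nat) (e : rel 'I_n) (x v : 'rV['F_2]_n) :
  x \in Sigma_e e ->
  corank (Hdenom (diag_mx (v + x)) (adjacency e)) =
  corank (Hdenom (diag_mx v) (adjacency e)).
Proof.
move/Sigma_eP=> Kx; rewrite (raddfD (@diag_mx _ n)) Hdenom_add //.
by rewrite corank_mulmxU //; case: (mulmx1_unit (Hdenom_involutive Kx)).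
Qed.

(** Each right coset of [G] contributes [#|G|] equal terms. *)
Lemma dvdz_sum_invariant (gT : finGroupType) (G : {group gT}) (f : gT -> int) :
  (forall x y, x \in G -> f (x * y)%g = f y) ->
  (#|G|%:Z %| \sum_x f x)%Z.
Proof.
move=> fG.
have -> : \sum_x f x = \sum_(x in [set: gT]) f x.
  by apply: eq_bigl => x; rewrite inE.
rewrite (set_partition_big _ (rcosets_partition (subsetT G))) /=.
apply: rpred_sum => _ /rcosetsP[y _ ->].
rewrite (eq_bigr (fun=> f y)) => [|_ /rcosetP[x Gx ->]]; last exact: fG.
by rewrite sumr_const card_rcoset -mulr_natr natz dvdz_mull.
Qed.

Lemma interlace_polyE (n : nat) (e : rel 'I_n) :
  interlace_poly e =
  \sum_v ('X - 1) ^+ corank (Hdenom (diag_mx v) (adjacency e)).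
Proof.
(* Indexing by vectors instead of subsets turns the index set into an additive group containing
   [Sigma_e e]. *)
rewrite (reindex (@indicator_row n)) /=; last first.
  by exists (@row_support n) => x _; rewrite (indicator_rowK, row_supportK).
by apply: eq_bigr => w _; rewrite corank_princ_submx.
Qed.

Theorem proposition12 (n : nat) (e : rel 'I_n)
    (e_sym : symmetric e) (e_irr : irreflexive e) :
  (forall i : nat, (#|Sigma_e e|%:Z %| (interlace_poly e)`_i)%Z) /\
  (Sigma_e e <> [set 0] ->
   forall i : nat, (2%:Z %| (interlace_poly e)`_i)%Z).
Proof.
pose G := Group (Sigma_e_group_set e).
have dvdG i : (#|Sigma_e e|%:Z %| (interlace_poly e)`_i)%Z.
  rewrite interlace_polyE coef_sum; apply: (@dvdz_sum_invariant _ G) => x v Gx.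
  by rewrite [(x * v)%g]addrC corank_Hdenom_Sigma_e.
split=> // nt i; apply: dvdz_trans (dvdG i).
have /trivgPn[x Gx ntx] : G :!=: 1%g by apply/eqP.
(* The group law is addition of row vectors, so squaring [x] means [x + x], and Lagrange's theorem
   makes the order of [Sigma_e e] even. *)
have x2 : #[x]%g = 2%N by apply: nt_prime_order => //; apply: addmx_F2.
by have := order_dvdG Gx; rewrite x2.
Qed.
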